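(* Let $A,B\in\mathbb Z$ and $\Delta=A^2-4B$. Let $p$ be an odd prime and let $m\in\mathbb Z$ with $p\nmid m$. Suppose that $p\nmid\Delta$ and $d^2\equiv m^2-4Am+16B\not\equiv0\pmod p$ where $d\in\mathbb Z$. Then $$\sum_{k=0}^{p-1}\frac{u_k(A,B)}{m^k}\binom{2k}k\equiv\begin{cases}0\pmod p&\text{if }(\frac{\Delta}p)=1,\\ -\frac 4d(\frac{2m}p)(\frac{m-d-2A}p)\pmod p&\text{if }(\frac{\Delta}p)=-1,\end{cases}$$ and $$\sum_{k=0}^{p-1}\frac{v_k(A,B)}{m^k}\binom{2k}k\equiv\begin{cases}2(\frac{2m}p)(\frac{m-d-2A}p)\pmod p&\text{if }(\frac{\Delta}p)=1,\\ \frac {4A-2m}d(\frac{2m}p)(\frac{m-d-2A}p)\pmod p&\text{if }(\frac{\Delta}p)=-1.\end{cases}$$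
   Context: For $A,B\in\mathbb Z$ the Lucas sequences are defined by $u_0=0$, $u_1=1$, $u_{n+1}=Au_n-Bu_{n-1}$ and $v_0=2$, $v_1=A$, $v_{n+1}=Av_n-Bv_{n-1}$ ($n\ge1$); we write $u_n(A,B)$, $v_n(A,B)$. $\left(\frac{\cdot}{p}\right)$ is the Legendre symbol. Congruences between rationals with denominators prime to $p$ are understood in the ring of such rationals (so e.g. $\frac4d$ means $4$ times the inverse of $d$ modulo $p$). *)

(* Defs.v *)
From mathcomp Require Import all_boot all_order all_algebra.

Set Implicit Arguments.
Unset Strict Implicit.
Unset Printing Implicit Defensive.

Import Order.TTheory GRing.Theory Num.Theory.
Local Open Scope ring_scope.

Fixpoint lucas_u (A B : int) (n : nat) : int :=
  match n with
  | 0%N => 0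
  | n1.+1 => match n1 with
             | 0%N => 1
             | n2.+1 => A * lucas_u A B n1 - B * lucas_u A B n2
             end
  end.

Fixpoint lucas_v (A B : int) (n : nat) : int :=
  match n with
  | 0%N => 2
  | n1.+1 => match n1 with
             | 0%N => A
             | n2.+1 => A * lucas_v A B n1 - B * lucas_v A B n2
             end
  end.

(* Meaningful for p an odd prime; 'I_p is a complete system of residues. *)
Definition legendre (a : int) (p : nat) : int :=
  if (p %| a)%Z then 0
  else if [exists x : 'I_p, ((x%:Z ^+ 2)%R == a %[mod p])%Z] then 1
  else -1.

Definition p_integral (p : nat) (x : rat) : Prop := ~~ (p %| denq x)%Z.

(* Congruence modulo the ideal generated by p in the ring of p-integral
   rationals; membership of both sides in that ring is part of the claim. *)
Definition ratcong (p : nat) (x y : rat) : Prop :=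
  [/\ p_integral p x, p_integral p y
    & exists2 z : rat, p_integral p z & x - y = p%:R * z].

(* Main.v *)
(* Work in an algebraically closed field K of characteristic p = 2n + 1, where
   the polynomial X^2 - A X + B has roots x, y.  For k < p, the coefficient
   C(2k, k) equals (-4)^k C(n, k) in K, so sum_k C(2k, k) (x / m)^k is
   (1 - 4 x / m)^n = (m / p) (m - 4 x)^n, and both sums follow from a^n and b^n
   with a = m - 4 x, b = m - 4 y.  Here a b = d^2, and for
   c = a + b - 2 d = 2 (m - d - 2 A) we have a c = (a - d)^2; hence
   a^n c^n = (a - d)^(p - 1) = (a^p - d) / (a - d).  Finally a^p is a or b
   according to whether the discriminant is a square mod p or not. *)
Require Import Defs.
From mathcomp Require Import all_boot all_order all_algebra.
From mathcomp Require Import all_field ring zify.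
Import Order.TTheory GRing.Theory Num.Theory.
Local Open Scope ring_scope.

Set Implicit Arguments.
Unset Strict Implicit.

(** * The prime field inside a field of characteristic p, and Euler's criterion *)

Lemma exists_pchar_closedField (p : nat) :
  prime p -> exists K : closedFieldType, p \in [pchar K].
Proof.
move=> p_pr; have [K [f _]] := countable_algebraic_closure 'F_p.
by exists K; apply: (rmorph_pchar f); apply: pchar_Fp.
Qed.

Lemma closedField_sqrt (K : closedFieldType) (x : K) : exists y : K, y ^+ 2 = x.
Proof.
have [y y2] := @solve_monicpoly K 2 (fun i => if i is 0%N then x else 0) isT.
by exists y; rewrite y2 !big_ord_recl big_ord0 /= mulr1 mul0r !addr0.
Qed.

Section CharP.

Variables (K : fieldType) (p : nat).
Hypothesis pK : p \in [pchar K].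

Lemma intr_eq0_pchar (a : int) : (a%:~R == 0 :> K) = (p %| a)%Z.
Proof.
have h (n : nat) : (n%:R == 0 :> K) = (p %| n)%N by rewrite -(dvdn_pcharf pK).
case: a => n; first by rewrite -pmulrn h.
by rewrite NegzE mulrNz oppr_eq0 -pmulrn h.
Qed.

Lemma intr_eq_pchar (a b : int) : (a%:~R == b%:~R :> K) = (a == b %[mod p])%Z.
Proof. by rewrite eqz_mod_dvd -intr_eq0_pchar rmorphB subr_eq0. Qed.

Lemma intr_expp (a : int) : a%:~R ^+ p = a%:~R :> K.
Proof. by rewrite -(pFrobenius_autE pK) rmorph_int. Qed.

(** The residues of 0, ..., p - 1 are already p distinct roots of X^p - X, so a root [y] outside
    them would exceed the degree. *)
Lemma exprp_fixed (y : K) : y ^+ p = y -> exists2 i : nat, (i < p)%N & y = i%:R.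
Proof.
move=> yp; have p_gt1 := prime_gt1 (pcharf_prime pK).
pose rs : seq K := [seq i%:R | i <- iota 0 p].
have [/mapP[i]|yNrs] := boolP (y \in rs).
  by rewrite mem_iota => /andP[_ ip] ->; exists i.
have szq : size ('X^p - 'X : {poly K}) = p.+1.
  by rewrite size_polyDl size_polyXn // size_polyN size_polyX.
have q0 : 'X^p - 'X != 0 :> {poly K} by rewrite -size_poly_eq0 szq.
have := @max_poly_roots _ _ (y :: rs) q0.
rewrite szq /= yNrs size_map size_iota ltnn => bound; case: notF; apply: bound.
- rewrite rootE !hornerE yp subrr eqxx /=; apply/allP => _ /mapP[i _ ->].
  by rewrite rootE !hornerE (intr_expp i%:Z) subrr.
- rewrite map_inj_in_uniq ?iota_uniq // => i j.
  rewrite !mem_iota /= => ip jp /eqP.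
  rewrite (_ : _ == _ = ((i%:Z)%:~R == (j%:Z)%:~R :> K)) // intr_eq_pchar.
  by rewrite !modz_nat !modn_small // => /eqP[].
Qed.

End CharP.

(** For nonzero a, Fermat gives a^n = 1 or -1. If a^n = 1, a square root y of a in [K] satisfies y^p
    = a^n y = y, so y lies in the prime field and a is a square mod p. *)
Lemma euler_criterion (K : closedFieldType) (n : nat) (a : int) :
  n.*2.+1 \in [pchar K] -> (legendre a n.*2.+1)%:~R = a%:~R ^+ n :> K.
Proof.
set p := n.*2.+1 => pK; rewrite /legendre -(intr_eq0_pchar pK).
have n_gt0 : (0 < n)%N by have := prime_gt1 (pcharf_prime pK); rewrite /p; lia.
case: eqVneq => [->|a0]; first by rewrite expr0n; case: n n_gt0 {p pK}.
case: existsP => [[x]|nosq].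
  rewrite -(intr_eq_pchar pK) rmorphXn => /eqP xa.
  rewrite -xa in a0 *; rewrite -exprM mul2n.
  have x0 : (x%:Z)%:~R != 0 :> K by move: a0; rewrite expf_eq0.
  by apply: (mulfI x0); rewrite mulr1 -exprS (intr_expp pK).
have : a%:~R ^+ n ^+ 2 == 1 :> K.
  rewrite -exprM muln2; apply/eqP; apply: (mulfI a0).
  by rewrite -exprS (intr_expp pK) mulr1.
rewrite sqrf_eq1 => /orP[/eqP an1|/eqP ->]; last by rewrite mulrNz.
have [y ya] := closedField_sqrt (a%:~R : K).
have /(exprp_fixed pK)[i ip yi] : y ^+ p = y.
  by rewrite exprS -mul2n exprM ya an1 mulr1.
case: nosq; exists (Ordinal ip).
by rewrite -(intr_eq_pchar pK) rmorphXn /= -ya yi.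
Qed.

(* Both sides obey c(k+1) (k+1) = 2 (2k+1) c(k), because 2n = -1 in K. *)
Lemma central_bin_pchar (K : fieldType) (n k : nat) :
    n.*2.+1 \in [pchar K] -> (k < n.*2.+1)%N ->
  'C(2 * k, k)%:R = (-4) ^+ k * 'C(n, k)%:R :> K.
Proof.
move=> pK; elim: k => [|k IH] kp; first by rewrite !bin0 mulr1.
have k1 : k.+1%:R != 0 :> K by rewrite -(dvdn_pcharf pK) gtnNdvd.
have e1 : (k.+1 * 'C(2 * k.+1, k.+1) = 2 * (2 * k).+1 * 'C(2 * k, k))%N.
  have h1 := mul_bin_diag (2 * k).+2 k; have h2 := mul_bin_down (2 * k).+1 k.
  rewrite /= in h1 h2; rewrite (_ : 2 * k.+1 = (2 * k).+2)%N; last by lia.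
  rewrite -h1; apply/eqP; rewrite -(eqn_pmul2l (ltn0Sn k)); apply/eqP.
  by move: h2; rewrite (_ : (2 * k).+1 - k = k.+1)%N; nia.
have e2 : k.+1%:R * 'C(n, k.+1)%:R = (n%:R - k%:R) * 'C(n, k)%:R :> K.
  (* The subtraction in [mul_bin_left] is truncated; it differs from the one in [K] only for n < k,
     where C(n, k) = 0. *)
  rewrite -natrM mul_bin_left natrM; have [kn|nk] := leqP k n.
    by rewrite natrB.
  by rewrite bin_small ?mulr0.
have e3 : n%:R * 2 + 1 = 0 :> K.
  by rewrite -(pcharf0 pK) -(natr1 n.*2) -muln2 natrM.
apply: (mulfI k1); rewrite -natrM e1 natrM natrM IH ?(ltnW kp) //.
rewrite exprS [RHS]mulrCA e2 -(natr1 (2 * k)) natrM.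
(* Subtracting the null quantity 2n + 1 turns 2 (2k + 1) into -4 (n - k). *)
rewrite [RHS](_ : _ =
  2 * (2 * k%:R + 1 - (n%:R * 2 + 1)) * ((-4) ^+ k * 'C(n, k)%:R)).
  by rewrite e3; ring.
by ring.
Qed.

Lemma sum_central_bin_pchar (K : fieldType) (n : nat) (x : K) :
    n.*2.+1 \in [pchar K] ->
  \sum_(0 <= k < n.*2.+1) x ^+ k * 'C(2 * k, k)%:R = (1 - 4 * x) ^+ n.
Proof.
move=> pK; rewrite exprDn -(big_mkord predT
  (fun i => 1 ^+ (n - i) * (- (4 * x)) ^+ i *+ 'C(n, i))).
(* The binomial expansion stops at k = n; the terms with n < k < p vanish because C(n, k) = 0. *)
rewrite (big_cat_nat (n := n.+1)) //=; last by lia.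
rewrite [X in _ + X]big1_seq ?addr0 => [|k]; last first.
  rewrite mem_index_iota => /andP[_ /andP[nk kp]].
  by rewrite (central_bin_pchar pK) // bin_small // !mulr0.
apply: eq_big_nat => k /andP[_ kn].
rewrite (central_bin_pchar pK); last by lia.
by rewrite expr1n mul1r -mulNr exprMn -[RHS]mulr_natr mulrA [x ^+ k * _]mulrC.
Qed.

(* [t] is the residue of [x]: the denominator [b] is prime to the characteristic. *)
Definition reduces_to (K : fieldType) (x : rat) (t : K) : Prop :=
  exists a b : int,
    [/\ x = a%:~R / b%:~R, b%:~R != 0 :> K & a%:~R = t * b%:~R].

(** * Transfer of congruences between rationals to equalities in K *)

Section Reduction.

Variable K : fieldType.
Implicit Types (x y : rat) (s t : K).

Let intr_neq0 (b : int) : b%:~R != 0 :> K -> b%:~R != 0 :> rat.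
Proof. by apply: contraNneq => /eqP; rewrite intr_eq0 => /eqP->. Qed.

Lemma reduces_int (a : int) : reduces_to a%:~R (a%:~R : K).
Proof. by exists a, 1; rewrite divr1 mulr1 oner_neq0. Qed.

Lemma reduces_nat (a : nat) : reduces_to a%:R (a%:R : K).
Proof. exact: (reduces_int a). Qed.

Lemma reducesD x y s t :
  reduces_to x s -> reduces_to y t -> reduces_to (x + y) (s + t).
Proof.
move=> [a [b [-> b0 ab]]] [c [d [-> d0 cd]]].
exists (a * d + c * b), (b * d); split.
- by rewrite !(rmorphD, rmorphM) addf_div // intr_neq0.
- by rewrite rmorphM mulf_neq0.
- by rewrite !(rmorphD, rmorphM) /= ab cd; ring.
Qed.

Lemma reducesM x y s t :
  reduces_to x s -> reduces_to y t -> reduces_to (x * y) (s * t).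
Proof.
move=> [a [b [-> b0 ab]]] [c [d [-> d0 cd]]].
exists (a * c), (b * d); split.
- by rewrite !rmorphM mulf_div.
- by rewrite rmorphM mulf_neq0.
- by rewrite !rmorphM /= ab cd; ring.
Qed.

Lemma reducesN x t : reduces_to x t -> reduces_to (- x) (- t).
Proof.
rewrite -mulN1r -[- t]mulN1r; apply: reducesM.
by have := reduces_int (-1); rewrite !rmorphN1.
Qed.

Lemma reducesV x t : t != 0 -> reduces_to x t -> reduces_to x^-1 t^-1.
Proof.
move=> t0 [a [b [-> b0 ab]]]; exists b, a; split.
- by rewrite invf_div.
- by rewrite ab mulf_neq0.
- by rewrite ab mulKf.
Qed.

Lemma reducesX x t (k : nat) : reduces_to x t -> reduces_to (x ^+ k) (t ^+ k).
Proof.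
move=> xt; elim: k => [|k IH]; first exact: reduces_nat 1.
by rewrite !exprS; apply: reducesM.
Qed.

Lemma reduces_sum (r : seq nat) (F : nat -> rat) (G : nat -> K) :
    (forall k, reduces_to (F k) (G k)) ->
  reduces_to (\sum_(k <- r) F k) (\sum_(k <- r) G k).
Proof.
move=> FG; apply: (big_ind2 (@reduces_to K)) => //; first exact: reduces_nat 0.
by move=> x s y t; apply: reducesD.
Qed.

(** The difference has residue 0, so it can be written with a numerator divisible by p over a
    denominator prime to p. *)
Lemma ratcong_of_reduces (p : nat) x y t :
  p \in [pchar K] -> reduces_to x t -> reduces_to y t -> ratcong p x y.
Proof.
move=> pK; have integral z s : reduces_to z s -> p_integral p z.
  move=> [a [b [-> b0 _]]]; rewrite /p_integral; move: b0.
  rewrite (intr_eq0_pchar pK); case: divqP => [|k u _]; first by rewrite dvdz0.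
  by apply: contraNN; apply: dvdz_mull.
move=> xt yt; split; [exact: integral xt|exact: integral yt|].
have [a [b [-> b0]]] := reducesD xt (reducesN yt).
rewrite subrr mul0r => /eqP; rewrite (intr_eq0_pchar pK) => /dvdzP[c ->].
exists (c%:~R / b%:~R); last by rewrite rmorphM /=; ring.
by apply: (integral _ (c%:~R / b%:~R)); exists c, b; rewrite divfK.
Qed.

End Reduction.

(** * Lucas sequences and their sums in K *)

Lemma lucas_binet (K : fieldType) (A B : int) (x y : K) (k : nat) :
    x + y = A%:~R -> x * y = B%:~R ->
  (x - y) * (lucas_u A B k)%:~R = x ^+ k - y ^+ k /\
  (lucas_v A B k)%:~R = x ^+ k + y ^+ k.
Proof.
(* The recurrence has order two, so the induction carries two consecutive indices. *)
move=> sxy pxy; suff: forall k, [/\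
    (x - y) * (lucas_u A B k)%:~R = x ^+ k - y ^+ k,
    (x - y) * (lucas_u A B k.+1)%:~R = x ^+ k.+1 - y ^+ k.+1,
    (lucas_v A B k)%:~R = x ^+ k + y ^+ k &
    (lucas_v A B k.+1)%:~R = x ^+ k.+1 + y ^+ k.+1].
  by move=> /(_ k)[].
elim=> [|j [u0 u1 v0 v1]]; first by rewrite /= mulr0 mulr1 subrr sxy; split.
split=> //.
  rewrite [lucas_u A B j.+2]/(A * lucas_u A B j.+1 - B * lucas_u A B j).
  rewrite rmorphB !rmorphM /= -sxy -pxy mulrBr mulrCA u1 mulrCA u0 !exprS; ring.
rewrite [lucas_v A B j.+2]/(A * lucas_v A B j.+1 - B * lucas_v A B j).
by rewrite rmorphB !rmorphM /= -sxy -pxy v1 v0 !exprS; ring.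
Qed.

Section LucasSums.

Variables (K : fieldType) (n : nat).
Hypothesis pK : n.*2.+1 \in [pchar K].

Lemma intr_exp_half (a : int) :
  a%:~R != 0 :> K -> a%:~R ^+ n * a%:~R ^+ n = 1 :> K.
Proof.
by move=> a0; apply: (mulfI a0); rewrite -exprD addnn -exprS (intr_expp pK) mulr1.
Qed.

Let S (m x : K) : K :=
  \sum_(0 <= k < n.*2.+1) x ^+ k / m ^+ k * 'C(2 * k, k)%:R.

(** Taking 1/m out of 1 - 4x/m leaves m^(-n), which is m^n since m^(2n) = 1. *)
Let S_closed (m : int) (x : K) : m%:~R != 0 :> K ->
  S m%:~R x = m%:~R ^+ n * (m%:~R - 4 * x) ^+ n.
Proof.
move=> m0; rewrite /S.
under eq_bigr do rewrite -expr_div_n.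
rewrite sum_central_bin_pchar // -[RHS]mul1r -[in RHS](intr_exp_half m0).
rewrite (_ : 1 - _ = (m%:~R - 4 * x) / m%:~R); last by field.
rewrite expr_div_n -mulrA [in RHS]mulrA (intr_exp_half m0) mul1r mulrC.
congr (_ * _); apply: (mulfI (expf_neq0 n m0)).
by rewrite mulfV ?expf_neq0 ?intr_exp_half.
Qed.

Variables (A B m : int) (x y : K).
Hypotheses (m0 : m%:~R != 0 :> K) (sxy : x + y = A%:~R) (pxy : x * y = B%:~R).

Lemma sum_lucas_u_pchar :
  (x - y) * (\sum_(0 <= k < n.*2.+1)
    (lucas_u A B k)%:~R / m%:~R ^+ k * 'C(2 * k, k)%:R)
  = m%:~R ^+ n * ((m%:~R - 4 * x) ^+ n - (m%:~R - 4 * y) ^+ n).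
Proof.
rewrite [RHS]mulrBr -!S_closed // /S -sumrB mulr_sumr; apply: eq_bigr => k _.
by rewrite !mulrA (lucas_binet k sxy pxy).1 -!mulrA -mulrBl.
Qed.

Lemma sum_lucas_v_pchar :
  \sum_(0 <= k < n.*2.+1)
    (lucas_v A B k)%:~R / m%:~R ^+ k * 'C(2 * k, k)%:R
  = m%:~R ^+ n * ((m%:~R - 4 * x) ^+ n + (m%:~R - 4 * y) ^+ n).
Proof.
rewrite [RHS]mulrDr -!S_closed // /S -big_split; apply: eq_bigr => k _ /=.
by rewrite (lucas_binet k sxy pxy).2 -!mulrA -mulrDl.
Qed.

(** * The n-th power of a when a b is a square; a and b may be exchanged *)

Section HalfPower.

Variables (a b d : K) (c : int).
Hypotheses (abd : a * b = d ^+ 2) (aNb : a != b) (a0 : a != 0).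
Hypotheses (dp : d ^+ n.*2.+1 = d) (cE : c%:~R = a + b - 2 * d).

Let a_neq_d : a - d != 0.
Proof.
rewrite subr_eq0; apply: contraNneq aNb => ad; apply/eqP.
by apply: (mulfI a0); rewrite abd ad.
Qed.

(** Frobenius gives a^p - d = (a - d)^p = (a - d) (a c)^n. As [c] is an integer, c^(2n) = 1, so
    multiplying by c^n isolates a^n. *)
Let half_power : a ^+ n * (a - d) = c%:~R ^+ n * (a ^+ n.*2.+1 - d).
Proof.
have ac : a * c%:~R = (a - d) ^+ 2 by rewrite cE sqrrB -abd; ring.
have c0 : c%:~R != 0 :> K.
  by apply: contraNneq a_neq_d => c0; rewrite -sqrf_eq0 -ac c0 mulr0.
have -> : a ^+ n.*2.+1 - d = (a - d) * (a * c%:~R) ^+ n.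
  rewrite ac -exprM mul2n -exprS -[RHS](pFrobenius_autE pK) rmorphB /=.
  by rewrite !(pFrobenius_autE pK) dp.
by rewrite exprMn -[LHS]mul1r -[X in X * _ = _](intr_exp_half c0); ring.
Qed.

Lemma half_power_split : a ^+ n.*2.+1 = a -> a ^+ n = c%:~R ^+ n.
Proof. by move=> ap; apply: (mulIf a_neq_d); rewrite half_power ap. Qed.

(** Since a b = d^2, b - d = -(b / d) (a - d), and the factor a - d cancels. *)
Lemma half_power_inert : a ^+ n.*2.+1 = b -> a ^+ n = - (c%:~R ^+ n * b / d).
Proof.
move=> ap; have d0 : d != 0.
  have : a * b != 0 by rewrite -ap mulf_neq0 ?expf_neq0.
  by rewrite abd expf_eq0.
apply: (mulIf a_neq_d); rewrite half_power ap.
rewrite (_ : - _ * _ = c%:~R ^+ n * (b - a * b / d)); last by field.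
by rewrite abd expr2 mulfK.
Qed.

End HalfPower.

End LucasSums.

Theorem theorem1p3 (A B : int) (p : nat) (m d : int)
    (p_prime : prime p) (p_odd : odd p)
    (p_ndvd_m : ~~ (p %| m)%Z)
    (p_ndvd_Delta : ~~ (p %| (A ^+ 2 - 4 * B)%R)%Z)
    (d_sqr : ((d ^+ 2)%R = (m ^+ 2 - 4 * A * m + 16 * B)%R %[mod p])%Z)
    (d_sqr_neq0 : ((m ^+ 2 - 4 * A * m + 16 * B)%R <> 0 %[mod p])%Z) :
  let Delta : int := A ^+ 2 - 4 * B in
  let eps : rat := (legendre (2 * m) p * legendre (m - d - 2 * A) p)%:~R in
  let Su : rat :=
    \sum_(0 <= k < p) (lucas_u A B k)%:~R / m%:~R ^+ k * ('C(2 * k, k))%:R in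
  let Sv : rat :=
    \sum_(0 <= k < p) (lucas_v A B k)%:~R / m%:~R ^+ k * ('C(2 * k, k))%:R in
  ((legendre Delta p = 1 -> ratcong p Su 0) /\
   (legendre Delta p = -1 -> ratcong p Su (- (4 / d%:~R) * eps))) /\
  ((legendre Delta p = 1 -> ratcong p Sv (2 * eps)) /\
   (legendre Delta p = -1 ->
      ratcong p Sv ((4 * A - 2 * m)%:~R / d%:~R * eps))).
Proof.
have [K pK] := exists_pchar_closedField p_prime.
have [n pE] : exists n, p = n.*2.+1.
  by exists p./2; rewrite -[LHS]odd_double_half p_odd.
subst p; move=> Delta eps Su Sv.
rewrite -(intr_eq0_pchar pK) in p_ndvd_m.
rewrite -/Delta -(intr_eq0_pchar pK) in p_ndvd_Delta.
have two0 : 2 != 0 :> K.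
  rewrite -(dvdn_pcharf pK); apply/negP => /dvdn_leq.
  by have := prime_gt1 p_prime; lia.
have four0 : 4 != 0 :> K by rewrite (natrM _ 2 2) mulf_neq0.
have dK : d%:~R ^+ 2 = m%:~R ^+ 2 - 4 * A%:~R * m%:~R + 16 * B%:~R :> K.
  move/eqP: d_sqr; rewrite -(intr_eq_pchar pK) => /eqP.
  by rewrite !(rmorphXn, rmorphD, rmorphN, rmorphM).
have d0 : d%:~R != 0 :> K.
  apply/eqP => d0; apply: d_sqr_neq0; apply/eqP; rewrite -(intr_eq_pchar pK).
  by rewrite !(rmorphXn, rmorphD, rmorphN, rmorphM) /= -dK d0 expr0n.
have [dl dlE] := closedField_sqrt (Delta%:~R : K).
pose x := (A%:~R + dl) / 2; pose y := (A%:~R - dl) / 2.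
(* Frobenius multiplies the square root of Delta by Delta^n, that is, by its Legendre symbol: it
   fixes or exchanges the two roots. *)
have dlp : dl ^+ n.*2.+1 = (legendre Delta n.*2.+1)%:~R * dl.
  by rewrite (euler_criterion _ pK) exprS -mul2n exprM dlE mulrC.
have dl0 : dl != 0 by apply: contraNneq p_ndvd_Delta => dl0; rewrite -dlE dl0 expr0n.
have sxy : x + y = A%:~R by rewrite /x /y; field.
have DK : dl ^+ 2 = A%:~R ^+ 2 - 4 * B%:~R.
  by rewrite dlE /Delta !(rmorphXn, rmorphB, rmorphM).
have pxy : x * y = B%:~R.
  rewrite (_ : x * y = (A%:~R ^+ 2 - dl ^+ 2) / 4); last by rewrite /x /y; field; apply/andP.
  by rewrite DK; field.
have xy : x - y = dl by rewrite /x /y; field.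
pose a := m%:~R - 4 * x; pose b := m%:~R - 4 * y.
have abd : a * b = d%:~R ^+ 2 by rewrite dK -sxy -pxy /a /b; ring.
have aE : a = (m - 2 * A)%:~R - 2 * dl.
  by rewrite /a /x rmorphB rmorphM /=; field.
have bE : b = (m - 2 * A)%:~R + 2 * dl.
  by rewrite /b /y rmorphB rmorphM /=; field.
have aNb : a != b.
  rewrite -subr_eq0 aE bE (_ : _ - _ = - (2 * 2 * dl)); last by ring.
  by rewrite oppr_eq0 !mulf_neq0.
have /andP[a0 b0] : (a != 0) && (b != 0).
  by rewrite -negb_or -mulf_eq0 abd expf_neq0.
have cE : (2 * (m - d - 2 * A))%:~R = a + b - 2 * d%:~R :> K.
  by rewrite aE bE !(rmorphD, rmorphN, rmorphM) /=; ring.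
have cE' : (2 * (m - d - 2 * A))%:~R = b + a - 2 * d%:~R :> K.
  by rewrite cE [b + a]addrC.
have dp := intr_expp pK d.
have ap : a ^+ n.*2.+1 = (m - 2 * A)%:~R - 2 * (legendre Delta n.*2.+1)%:~R * dl.
  rewrite aE -(pFrobenius_autE pK) rmorphB rmorphM rmorph_int /=.
  rewrite !(pFrobenius_autE pK).
  by rewrite (intr_expp pK 2) dlp mulrA.
have bp : b ^+ n.*2.+1 = (m - 2 * A)%:~R + 2 * (legendre Delta n.*2.+1)%:~R * dl.
  rewrite bE -(pFrobenius_autE pK) rmorphD rmorphM rmorph_int /=.
  rewrite !(pFrobenius_autE pK).
  by rewrite (intr_expp pK 2) dlp mulrA.
(* The factor 2 of c passes to m, so that Euler's criterion identifies [e] with the residue of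
   [eps]. *)
pose e : K := m%:~R ^+ n * (2 * (m - d - 2 * A))%:~R ^+ n.
have eps_red : reduces_to eps e.
  rewrite /e (_ : _ * _ =
    (legendre (2 * m) n.*2.+1 * legendre (m - d - 2 * A) n.*2.+1)%:~R).
    exact: reduces_int.
  rewrite [RHS]rmorphM /= !(euler_criterion _ pK) -!exprMn -!rmorphM.
  by rewrite mulrCA mulrA.
have Sred (f : nat -> int) : reduces_to
    (\sum_(0 <= k < n.*2.+1) (f k)%:~R / m%:~R ^+ k * ('C(2 * k, k))%:R)
    (\sum_(0 <= k < n.*2.+1) (f k)%:~R / m%:~R ^+ k * ('C(2 * k, k))%:R : K).
  apply: reduces_sum => k; apply: reducesM (reduces_nat _ _).
  apply: reducesM (reduces_int _ _) _.
  by apply: reducesV (reducesX _ (reduces_int _ _)); rewrite expf_neq0.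
have d_red := reducesV d0 (reduces_int K d).
have /= := sum_lucas_u_pchar pK p_ndvd_m sxy pxy.
have /= := sum_lucas_v_pchar pK p_ndvd_m sxy pxy.
rewrite xy -/a -/b => SvE SuE.
have bad : b * a = d%:~R ^+ 2 by rewrite mulrC.
have bNa : b != a by rewrite eq_sym.
have split_case : legendre Delta n.*2.+1 = 1 ->
    a ^+ n = (2 * (m - d - 2 * A))%:~R ^+ n /\
    b ^+ n = (2 * (m - d - 2 * A))%:~R ^+ n.
  move=> L; rewrite L mulr1 -aE in ap; rewrite L mulr1 -bE in bp.
  rewrite (half_power_split pK abd aNb a0 dp cE ap).
  by rewrite (half_power_split pK bad bNa b0 dp cE' bp).
have inert_case : legendre Delta n.*2.+1 = -1 ->
    a ^+ n = - ((2 * (m - d - 2 * A))%:~R ^+ n * b / d%:~R) /\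
    b ^+ n = - ((2 * (m - d - 2 * A))%:~R ^+ n * a / d%:~R).
  move=> L; rewrite L mulrN1 mulNr opprK -bE in ap; rewrite L mulrN1 mulNr -aE in bp.
  rewrite (half_power_inert pK abd aNb a0 dp cE ap).
  by rewrite (half_power_inert pK bad bNa b0 dp cE' bp).
split; split=> [/split_case|/inert_case] [an bn];
  apply: (ratcong_of_reduces pK (Sred _)).
- rewrite (_ : \sum_(_ <= _ < _) _ = 0); first exact: (reduces_nat K 0).
  by apply: (mulfI dl0); rewrite SuE an bn subrr !mulr0.
- rewrite (_ : \sum_(_ <= _ < _) _ = - (4 * d%:~R^-1) * e).
    exact: reducesM (reducesN (reducesM (reduces_nat K 4) d_red)) eps_red.
  (* Here a^n - b^n = c^n (a - b) / d with a - b = -4 [dl], whence the constant -4/d. *)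
  apply: (mulfI dl0); rewrite SuE an bn /e aE bE; field; exact: d0.
- rewrite SvE an bn (_ : _ * _ = 2 * e); last by rewrite /e; ring.
  exact: reducesM (reduces_nat K 2) eps_red.
(* Here a^n + b^n = -c^n (a + b) / d with a + b = 2m - 4A. *)
- rewrite SvE an bn (_ : _ * _ = (4 * A - 2 * m)%:~R * d%:~R^-1 * e).
    exact: reducesM (reducesM (reduces_int K _) d_red) eps_red.
  by rewrite /e aE bE !(rmorphB, rmorphM) /=; field.
Qed.
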